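(* There exists a universal constant $\gamma_0>0$ such that for every finite domain $X$, every linear ordering imposed on $C_{all}=2^X=\{c:X\to\{0,1\}\}$, and every linear ordering of the family $\mathcal S$ of all $C_{all}$-realizable samples that extends the ordering by cardinality (smaller samples preferred), the cost caused by the greedy matching in the consistency graph $G=(C_{all},\mathcal S,E)$ is at least $\gamma_0\cdot\log_2|C_{all}|$ $(=\gamma_0|X|)$.
   Context: A labeled example is a pair $(x,b)\in X\times\{0,1\}$; a sample is a set of labeled examples. A concept $c$ is consistent with a sample $S$ if $c(x)=b$ for all $(x,b)\in S$; $S$ is realizable by a class $C$ if some $c\in C$ is consistent with it. The consistency graph is the bipartite graph $G=(C,\mathcal S,E)$ with $E=\{(c,S): c \text{ consistent with } S\}$. Both sides are linearly ordered by preference $\succ$; the ordering on $\mathcal S$ satisfies $|S|<|S'|\Rightarrow S\succ S'$. The greedy matching is produced by: start with $M=\emptyset$; while $M$ is not maximal, let $x^*$ be the most preferred concept that is unmatched and adjacent to some unmatched sample, let $y^*$ be the most preferred unmatched sample adjacent to $x^*$, and add $\{x^*,y^*\}$ to $M$. If $S_1\succ\dots\succ S_N$ lists $\mathcal S$ and $S_k$ is the least preferred sample matched by the greedy matching, its cost is $|S_k|$. *)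

(* Defs.v *)
From HB Require Import structures.
From mathcomp Require Import all_boot all_order all_algebra.
From mathcomp Require Import reals exp.

Set Implicit Arguments.
Unset Strict Implicit.
Unset Printing Implicit Defensive.

Import Order.TTheory GRing.Theory Num.Theory.

(* [r x y] reads "x is strictly preferred to y"; only the restriction of [r]
   to [A] is constrained. *)
Definition linear_preference (T : finType) (A : {set T}) (r : rel T) : Prop :=
  [/\ {in A, irreflexive r},
      {in A & &, transitive r}
    & {in A &, forall x y, x != y -> r x y || r y x}].

Definition most_preferred (T : finType) (r : rel T) (A : {set T}) : option T :=
  [pick x in A | [forall y in A, (y == x) || r x y]].

Definition least_preferred (T : finType) (r : rel T) (A : {set T}) : option T :=
  most_preferred (fun x y => r y x) A.

Section Greedy.

Variables (T U : finType) (A : {set T}) (B : {set U}) (adj : T -> U -> bool).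
Variables (prefA : rel T) (prefB : rel U).

Implicit Type M : {set T * U}.

Definition is_matching M : bool :=
  [forall e in M, [&& e.1 \in A, e.2 \in B & adj e.1 e.2]] &&
  [forall e in M, forall f in M, (e.1 == f.1) || (e.2 == f.2) ==> (e == f)].

Definition matched_left M : {set T} := [set e.1 | e in M].
Definition matched_right M : {set U} := [set e.2 | e in M].

Definition free_neighbours M (x : T) : {set U} :=
  [set y in B | (y \notin matched_right M) && adj x y].

Definition free_candidates M : {set T} :=
  [set x in A | (x \notin matched_left M) && (free_neighbours M x != set0)].

(* [M] is left unchanged exactly when no candidate remains, i.e. when [M] is
   a maximal matching. *)
Definition greedy_step M : {set T * U} :=
  if most_preferred prefA (free_candidates M) is Some x then
    if most_preferred prefB (free_neighbours M x) is Some y then (x, y) |: M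
    else M
  else M.

(* Every effective step matches a new element of [A], so #|A| steps reach the
   end of the loop; see [greedy_matching_maximal]. *)
Definition greedy_matching : {set T * U} := iter #|A| greedy_step set0.

Lemma most_preferred_ex (V : finType) (D E : {set V}) (r : rel V) :
  linear_preference D r -> E \subset D -> E != set0 ->
  exists2 x, most_preferred r E = Some x & x \in E.
Proof.
move=> [irr tr tot] sED /set0Pn[x0 x0E].
suff [x xE xP] : exists2 x, x \in E & [forall y in E, (y == x) || r x y].
  rewrite /most_preferred; case: pickP => [z /andP[zE _]|/(_ x)].
    by exists z.
  by rewrite xE xP.
pose dom x := #|[set y in E | r x y]|.
case: (arg_maxnP dom x0E) => x xE' xmax; have xE : x \in E := xE'; exists x => //.
apply/forallP => y; apply/implyP => yE; apply/orP.
have [->|nyx] := eqVneq y x; [by left | right].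
have xD := subsetP sED _ xE; have yD := subsetP sED _ yE.
case/orP: (tot y x yD xD nyx) => // ryx.
have /negP[] : ~~ (dom y <= dom x)%N; last exact: xmax.
rewrite -ltnNge; apply: proper_card; apply/properP; split.
  apply/subsetP => z; rewrite !inE => /andP[zE rxz]; rewrite zE /=.
  exact: (tr x y z xD yD (subsetP sED _ zE) ryx rxz).
have xEr u : (x \in [set z in E | r u z]) = r u x by rewrite in_set xE.
by exists x; rewrite xEr // irr.
Qed.

Lemma greedy_matching_maximal :
  linear_preference A prefA -> linear_preference B prefB ->
  maxset is_matching greedy_matching.
Proof.
move=> linA linB.
have stepP n : let M := iter n greedy_step set0 in
    is_matching M /\ (free_candidates M = set0 \/ #|matched_left M| = n).
  elim: n => [|n]; first (split; last by right; rewrite /matched_left imset0 cards0).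
    by apply/andP; split; apply/forallP => e; rewrite inE.
  rewrite /=; set M := iter n greedy_step set0 => -[mM dM].
  have [c0|cN] := eqVneq (free_candidates M) set0.
    rewrite /greedy_step.
    have -> : most_preferred prefA (free_candidates M) = None.
      rewrite c0 /most_preferred; case: pickP => // z; by rewrite inE.
    by split=> //; left.
  case: dM => [c0|cM]; first by rewrite c0 eqxx in cN.
  have sA : free_candidates M \subset A.
    by apply/subsetP => z; rewrite inE => /andP[].
  have [x ex xC] := most_preferred_ex linA sA cN.
  have /[!inE]/and3P[xA xM xN] := xC.
  have sB : free_neighbours M x \subset B.
    by apply/subsetP => z; rewrite inE => /andP[].
  have [y ey yC] := most_preferred_ex linB sB xN.
  have /[!inE]/and3P[yB yM xy] := yC.
  rewrite /greedy_step ex ey; split; last first.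
    by right; rewrite /matched_left imsetU1 cardsU1 [x \notin _]xM -/(matched_left M) cM.
  have neq e : e \in M -> (e.1 == x) = false /\ (e.2 == y) = false.
    move=> eM; split; apply/negbTE.
      by apply: contraNneq xM => <-; apply: imset_f.
    by apply: contraNneq yM => <-; apply: imset_f.
  case/andP: mM => /forall_inP m1 /forall_inP m2.
  apply/andP; split; apply/forall_inP => e /setU1P[->|eM] /=.
  - by rewrite xA yB xy.
  - exact: m1.
  - apply/forall_inP => f /setU1P[->|fM] /=; first by rewrite !eqxx.
    by have [n1 n2] := neq f fM; rewrite eq_sym n1 eq_sym n2.
  - apply/forall_inP => f /setU1P[->|fM] /=.
      by have [n1 n2] := neq e eM; rewrite n1 n2.
    by move/forall_inP: (m2 e eM); apply.
have [] := stepP #|A|; rewrite /= -/greedy_matching => mM cM.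
have c0 : free_candidates greedy_matching = set0.
  case: cM => // cA; apply/eqP; rewrite -subset0; apply/subsetP => x.
  have : matched_left greedy_matching == A.
    rewrite eqEcard cA leqnn andbT; apply/subsetP => z /imsetP[e eM ->].
    by case/andP: mM => /forall_inP /(_ e eM)/and3P[].
  by move=> /eqP eA; rewrite !inE eA andbA andbN.
apply/maxsetP; split=> // N mN sMN; apply/eqP; rewrite eqEsubset sMN andbT.
apply/subsetP => -[x y] xyN; apply: contraTT isT => xyM.
case/andP: mN => /forall_inP n1 /forall_inP n2.
have /= /and3P[xA yB xy] := n1 _ xyN.
have free e : e \in greedy_matching -> (x == e.1) || (y == e.2) -> False.
  move=> eM eq; have /forall_inP /(_ e (subsetP sMN _ eM)) := n2 _ xyN.
  by rewrite /= eq /= => /eqP eE; rewrite eE eM in xyM.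
suff : x \in free_candidates greedy_matching by rewrite c0 inE.
rewrite !inE xA /=; apply/andP; split.
  by apply/imsetP => -[e eM ex]; apply: (free e eM); rewrite ex eqxx.
apply/set0Pn; exists y; rewrite !inE yB xy andbT /=.
by apply/imsetP => -[e eM ey]; apply: (free e eM); rewrite ey eqxx orbT.
Qed.

End Greedy.

Definition consistent (X : finType) (c : {ffun X -> bool})
    (S : {set X * bool}) : bool :=
  [forall e in S, c e.1 == e.2].

Definition realizable_samples (X : finType) (C : {set {ffun X -> bool}}) :
    {set {set X * bool}} :=
  [set S | [exists c in C, consistent c S]].

Definition C_all (X : finType) : {set {ffun X -> bool}} := [set: {ffun X -> bool}].

(* The 0 branch is taken only when nothing is matched, which cannot happen for
   a nonempty class since the empty sample is consistent with every concept. *)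
Definition greedy_cost (X : finType) (C : {set {ffun X -> bool}})
    (prefC : rel {ffun X -> bool}) (prefS : rel {set X * bool}) : nat :=
  let M := greedy_matching C (realizable_samples C) (@consistent X) prefC prefS in
  if least_preferred prefS (matched_right M) is Some Sk then #|Sk| else 0.

Definition extends_cardinality (X : finType) (F : {set {set X * bool}})
    (prefS : rel {set X * bool}) : Prop :=
  {in F &, forall S S' : {set X * bool}, #|S| < #|S'| -> prefS S S'}.

Definition log2 (R : realType) (x : R) : R := (ln x / ln 2)%R.

(* Main.v *)
(** The full sample of a concept is consistent with that concept only, so a
    maximal matching of the consistency graph saturates the class.  Hence the
    [2 ^ n] concepts on [n] points inject into the subsets of [X * bool] of size
    at most the cost [k].  Weighting a subset [S] by [4 ^ #|~: S|] bounds the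
    number of those subsets by [4 ^ k * (5 / 4) ^ (2 * n)], so
    [2 ^ (5 * n) <= 2 ^ (2 * k) * 5 ^ (2 * n)]; cubing and using
    [5 ^ 3 = 125 <= 128 = 2 ^ 7] gives [15 * n <= 6 * k + 14 * n]. *)
Require Import Defs.
From mathcomp Require Import all_boot all_order all_algebra.
From mathcomp Require Import reals exp.

Set Implicit Arguments.
Unset Strict Implicit.
Unset Printing Implicit Defensive.

Import Order.TTheory GRing.Theory Num.Theory.

Section SmallSets.

Variable T : finType.

Lemma sum_expn_card_cardC (a b : nat) :
  \sum_(S : {set T}) a ^ #|S| * b ^ #|~: S| = (a + b) ^ #|T|.
Proof.
rewrite -prod_nat_const bigA_distr; apply: eq_bigr => S _.
rewrite [RHS](bigID (mem S)) /= -!prod_nat_const; congr (_ * _).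
  by apply: eq_bigr => i ->.
by apply: eq_big => i; rewrite inE // => /negbTE ->.
Qed.

Lemma card_small_sets_le (a k : nat) : 0 < a ->
  #|[set S : {set T} | #|S| <= k]| * a ^ #|T| <= a ^ k * a.+1 ^ #|T|.
Proof.
move=> a_gt0; rewrite -add1n -sum_expn_card_cardC big_distrr -sum_nat_const /=.
rewrite [leqRHS](bigID (mem [set S : {set T} | #|S| <= k])) /=.
apply: leq_trans (leq_addr _ _); apply: leq_sum => S; rewrite inE => Sk.
by rewrite exp1n mul1n -expnD leq_pexp2l // -(cardsC S) leq_add2r.
Qed.

Lemma card_small_sets_cube_le (k : nat) :
  #|[set S : {set T} | #|S| <= k]| ^ 3 <= 2 ^ (6 * k + #|T|).
Proof.
set N := #|_|; set m := #|T|.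
have weighted : N * 4 ^ m <= 4 ^ k * 5 ^ m by apply: card_small_sets_le.
have cubed : N ^ 3 * 2 ^ (6 * m) <= 2 ^ (6 * k) * 5 ^ (3 * m).
  have cube4 j : 2 ^ (6 * j) = (4 ^ j) ^ 3 by rewrite expnAC expnM.
  have cube5 : 5 ^ (3 * m) = (5 ^ m) ^ 3 by rewrite expnAC expnM.
  by rewrite !cube4 cube5 -!expnMn leq_exp2r.
have five_cubed_le : 5 ^ (3 * m) <= 2 ^ (7 * m).
  by rewrite (expnM 5 3) (expnM 2 7); case: (m) => [|j]; [|rewrite leq_exp2r].
rewrite -(@leq_pmul2r (2 ^ (6 * m))) ?expn_gt0 //.
apply: leq_trans cubed _; rewrite -expnD -addnA -mulSn expnD.
by rewrite leq_mul2l five_cubed_le orbT.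
Qed.

End SmallSets.

Section Matching.

Variables (T U : finType) (A : {set T}) (B : {set U}) (adj : T -> U -> bool).

Implicit Type M : {set T * U}.

Lemma is_matchingP M :
  reflect [/\ {in M, forall e, [/\ e.1 \in A, e.2 \in B & adj e.1 e.2]},
              {in M &, injective fst} & {in M &, injective snd}]
          (is_matching A B adj M).
Proof.
apply: (iffP andP) => [[/forall_inP edgeM /forall_inP disjM]|[edgeM inj1 inj2]].
  have eq_edge e f :
      e \in M -> f \in M -> (e.1 == f.1) || (e.2 == f.2) -> e = f.
    by move=> eM fM ef; apply/eqP/(implyP (forall_inP (disjM e eM) f fM)).
  split=> [e /edgeM/and3P//|e f eM fM ef|e f eM fM ef]; apply: eq_edge => //.
    by rewrite ef eqxx.
  by rewrite ef eqxx orbT.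
split; apply/forall_inP => e eM; first by apply/and3P; apply: edgeM.
apply/forall_inP => f fM; apply/implyP => /orP[]/eqP ef; apply/eqP.
  exact: inj1.
exact: inj2.
Qed.

Lemma matched_right_sub M : is_matching A B adj M -> matched_right M \subset B.
Proof.
case/is_matchingP=> edgeM _ _.
by apply/subsetP => y /imsetP[e /edgeM[_ eB _] ->].
Qed.

Lemma card_matched_right M :
  is_matching A B adj M -> #|matched_right M| = #|matched_left M|.
Proof. by case/is_matchingP=> _ inj1 inj2; rewrite !card_in_imset. Qed.

Lemma is_matchingU1 M x y :
    is_matching A B adj M -> x \in A -> y \in B -> adj x y ->
    x \notin matched_left M -> y \notin matched_right M ->
  is_matching A B adj ((x, y) |: M).
Proof.
case/is_matchingP=> edgeM inj1 inj2 xA yB xy xM yM.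
apply/is_matchingP; split.
- by move=> e /setU1P[->|/edgeM].
- move=> e f /setU1P[->|eM] /setU1P[->|fM] //= ef; last exact: inj1.
    by rewrite ef imset_f in xM.
  by rewrite -ef imset_f in xM.
- move=> e f /setU1P[->|eM] /setU1P[->|fM] //= ef; last exact: inj2.
    by rewrite ef imset_f in yM.
  by rewrite -ef imset_f in yM.
Qed.

Lemma maximal_matching_covers_edge M x y :
    maxset (is_matching A B adj) M -> x \in A -> y \in B -> adj x y ->
  (x \in matched_left M) || (y \in matched_right M).
Proof.
case/maxsetP=> matchM maxM xA yB xy.
apply: contraT; rewrite negb_or => /andP[xM yM].
have addM : (x, y) |: M = M.
  by apply: maxM (subsetUr _ _); apply: is_matchingU1.
by case/negP: xM; apply/imsetP; exists (x, y); rewrite // -addM setU11.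
Qed.

Lemma maximal_matching_saturates M (f : T -> U) :
    maxset (is_matching A B adj) M -> {in A, forall x, f x \in B} ->
    {in A &, forall x x', adj x (f x') = (x == x')} ->
  matched_left M = A.
Proof.
move=> maxM fB adj_f; have /is_matchingP[edgeM _ _] := maxsetp maxM.
apply/eqP; rewrite eqEsubset; apply/andP; split; apply/subsetP => x.
  by case/imsetP=> e /edgeM[eA _ _] ->.
move=> xA; have xfx : adj x (f x) by rewrite adj_f.
case/orP: (maximal_matching_covers_edge maxM xA (fB x xA) xfx) => //.
case/imsetP=> e eM fx_e; have [eA _] := edgeM e eM.
by rewrite -fx_e adj_f // => /eqP <-; apply: imset_f.
Qed.

End Matching.

Section LeastPreferred.

Variables (T : finType) (A : {set T}) (r : rel T).
Hypothesis linA : linear_preference A r.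

Lemma linear_preference_converse : linear_preference A (fun x y => r y x).
Proof.
case: linA => irr tr tot; split=> //.
- by move=> y x z yA xA zA ryx rzy; apply: (tr y z x).
- by move=> x y xA yA; rewrite eq_sym => /(tot _ _ yA xA).
Qed.

Lemma linear_preference_asym : {in A &, forall x y, r x y -> ~~ r y x}.
Proof.
case: linA => irr tr _ x y xA yA rxy; apply/negP => ryx.
by have := tr _ _ _ yA xA xA rxy ryx; rewrite irr.
Qed.

Lemma least_preferred_ex (E : {set T}) : E \subset A -> E != set0 ->
  exists x, [/\ least_preferred r E = Some x, x \in E
              & {in E, forall y, y != x -> r y x}].
Proof.
move=> EA E0.
have [x Ex xE] := most_preferred_ex linear_preference_converse EA E0.
exists x; split=> // y yE yx; move: Ex.
rewrite /least_preferred /most_preferred.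
case: pickP => // _ /[swap] -[->] /andP[_ /forall_inP/(_ y yE)].
by rewrite (negbTE yx).
Qed.

End LeastPreferred.

Section ConsistencyGraph.

Variables (X : finType) (C : {set {ffun X -> bool}}).

Definition full_sample (c : {ffun X -> bool}) : {set X * bool} :=
  [set e | c e.1 == e.2].

Lemma consistent_full_sample (c d : {ffun X -> bool}) :
  consistent c (full_sample d) = (c == d).
Proof.
apply/forall_inP/eqP => [cons|-> e]; last by rewrite inE.
by apply/ffunP => x; apply/eqP/(cons (x, d x)); rewrite inE.
Qed.

Lemma full_sample_realizable (c : {ffun X -> bool}) :
  c \in C -> full_sample c \in realizable_samples C.
Proof.
move=> cC; rewrite inE; apply/exists_inP; exists c => //.
by rewrite consistent_full_sample.
Qed.

Lemma maximal_consistency_matching_saturates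
    (M : {set {ffun X -> bool} * {set X * bool}}) :
  maxset (is_matching C (realizable_samples C) (@consistent X)) M ->
  matched_left M = C.
Proof.
move=> maxM; apply: (maximal_matching_saturates (f := full_sample) maxM).
  exact: full_sample_realizable.
by move=> c d _ _; apply: consistent_full_sample.
Qed.

Lemma card_le_least_preferred (F E : {set {set X * bool}})
    (r : rel {set X * bool}) (S : {set X * bool}) :
    linear_preference F r -> extends_cardinality F r ->
    E \subset F -> S \in E ->
  exists2 Sk, least_preferred r E = Some Sk & #|S| <= #|Sk|.
Proof.
move=> linF extF EF SE; have E0 : E != set0 by apply/set0Pn; exists S.
have [Sk [eSk SkE worst]] := least_preferred_ex linF EF E0; exists Sk => //.
have [->//|neq] := eqVneq S Sk.
have [SF SkF] := (subsetP EF S SE, subsetP EF Sk SkE).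
have := linear_preference_asym linF SF SkF (worst S SE neq).
by rewrite leqNgt; apply: contra; apply: extF.
Qed.

Variables (prefC : rel {ffun X -> bool}) (prefS : rel {set X * bool}).

Hypothesis linC : linear_preference C prefC.
Hypothesis linS : linear_preference (realizable_samples C) prefS.
Hypothesis extS : extends_cardinality (realizable_samples C) prefS.

Lemma card_class_le_small_samples :
  #|C| <= #|[set S : {set X * bool} | #|S| <= greedy_cost C prefC prefS]|.
Proof.
have maxM := greedy_matching_maximal (@consistent X) linC linS.
have matchM := maxsetp maxM.
have sub_realizable := matched_right_sub matchM.
rewrite -{1}(maximal_consistency_matching_saturates maxM).
rewrite -(card_matched_right matchM).
apply/subset_leq_card/subsetP => S SM; rewrite inE /greedy_cost.
by have [Sk ->] := card_le_least_preferred linS extS sub_realizable SM.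
Qed.

Lemma card_class_cube_le_greedy_cost :
  #|C| ^ 3 <= 2 ^ (6 * greedy_cost C prefC prefS + 2 * #|X|).
Proof.
have -> : 2 * #|X| = #|{: X * bool}| by rewrite card_prod card_bool mulnC.
apply: leq_trans (card_small_sets_cube_le _ _).
by rewrite leq_exp2r // card_class_le_small_samples.
Qed.

End ConsistencyGraph.

Lemma card_C_all (X : finType) : #|C_all X| = 2 ^ #|X|.
Proof. by rewrite cardsT card_ffun card_bool. Qed.

Lemma greedy_cost_C_all_ge (X : finType)
    (prefC : rel {ffun X -> bool}) (prefS : rel {set X * bool}) :
    linear_preference (C_all X) prefC ->
    linear_preference (realizable_samples (C_all X)) prefS ->
    extends_cardinality (realizable_samples (C_all X)) prefS ->
  #|X| <= 6 * greedy_cost (C_all X) prefC prefS.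
Proof.
move=> linC linS extS.
have := card_class_cube_le_greedy_cost linC linS extS.
by rewrite card_C_all -expnM leq_exp2l // mulnC mulSn leq_add2r.
Qed.

Local Open Scope ring_scope.

Lemma log2_expn2 (R : realType) (n : nat) : log2 ((2 ^ n)%:R : R) = n%:R.
Proof.
rewrite /log2 natrX lnXn // -[ln _ *+ _]mulr_natl mulfK //.
by rewrite gt_eqF // ln_gt0 // ltr1n.
Qed.

Theorem theorem4 (R : realType) :
  exists gamma0 : R, 0 < gamma0 /\
    forall (X : finType)
           (prefC : rel {ffun X -> bool}) (prefS : rel {set X * bool}),
      linear_preference (C_all X) prefC ->
      linear_preference (realizable_samples (C_all X)) prefS ->
      extends_cardinality (realizable_samples (C_all X)) prefS ->
      gamma0 * log2 (#|C_all X|%:R : R) <= (greedy_cost (C_all X) prefC prefS)%:R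
      /\ gamma0 * log2 (#|C_all X|%:R : R) = gamma0 * #|X|%:R.
Proof.
exists 6%:R^-1; split=> [|X prefC prefS linC linS extS].
  by rewrite invr_gt0 ltr0n.
rewrite card_C_all log2_expn2; split=> //.
by rewrite ler_pdivrMl ?ltr0n // -natrM ler_nat greedy_cost_C_all_ge.
Qed.
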